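(* Let $n$ be a positive integer, let $j,k_1,\ldots,k_l$ be non-negative integers, and let $i\in\mathbb{Z}$. For integers $s$ and positive integers $d$, let $r_d(s)$ be the residue of $s$ modulo $d$ (so $0\le r_d(s)<d$), and let $R_d=r_d(k_1)+r_d(k_2)+\cdots+ r_d(k_l)$. Then $$\mathbf{S}^i_n\left( {j \brack k_1,\ldots,k_l} \right)=\frac{1}{n} \sum_{\substack{d\mid n, \\ R_d<d}} {\lfloor \frac{j}{d} \rfloor \choose \lfloor \frac{k_1}{d} \rfloor,\ldots,\lfloor \frac{k_l}{d}\rfloor} \sum_{0 \leq s <d} \mathbf{S}^s_d \left( {r_d(j) \brack r_d(k_1),\ldots,r_d(k_l)} \right)c_d(i-s).$$
   Context: For non-negative integers $j,k_1,\ldots,k_l$, the $q$-multinomial coefficient ${ j \brack k_1, \ldots, k_l }\in\mathbb{Z}[q]$ equals $\frac{[j]!}{[k_1]!\cdots [k_l]!}$ if $k_1+\cdots+k_l=j$, where $[s]!=\prod_{t=1}^{s}(1+q+\cdots+q^{t-1})$, and equals $0$ if $k_1+\cdots+k_l\neq j$. The ordinary multinomial coefficient ${m\choose a_1,\ldots,a_l}$ is $\frac{m!}{a_1!\cdots a_l!}$ if $a_1+\cdots+a_l=m$ and $0$ otherwise. For a polynomial $f$ in $q$, a positive integer $d$ and $s\in\mathbb{Z}$, $\mathbf{S}^s_d(f)=\sum_{t\equiv s\pmod d,\ t\ge0}[q^t]f$, where $[q^t]f$ is the coefficient of $q^t$. For an integer $l$, the Ramanujan sum is $c_d(l)=\sum_{e\mid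 d,\ e\mid l}\mu(d/e)\,e$. *)

(* Defs.v *)
From mathcomp Require Import all_boot all_order all_algebra.

Set Implicit Arguments.
Unset Strict Implicit.
Unset Printing Implicit Defensive.

Import GRing.Theory.
Local Open Scope ring_scope.

Definition qfact (s : nat) : {poly int} :=
  \prod_(1 <= t < s.+1) \sum_(0 <= u < t) 'X^u.

(* The denominator is monic, so [%/] is genuine Euclidean division over the
   integers (no pseudo-division factor), and the quotient is exact. *)
Definition qmultinomial (j l : nat) (k : 'I_l -> nat) : {poly int} :=
  if (\sum_(x < l) k x)%N == j
  then qfact j %/ \prod_(x < l) qfact (k x)
  else 0.

Definition multinomial (m l : nat) (a : 'I_l -> nat) : nat :=
  if (\sum_(x < l) a x)%N == m
  then (m`! %/ \prod_(x < l) (a x)`!)%N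
  else 0%N.

(* Sum of the coefficients of [f] at exponents congruent to [s] modulo [d];
   those at exponents beyond [size f] vanish. *)
Definition coef_sum_mod (d : nat) (s : int) (f : {poly int}) : int :=
  \sum_(t < size f | (t%:Z == s %[mod d])%Z) f`_t.

(* Only meaningful for positive [n]. *)
Definition mobius (n : nat) : int :=
  if all (fun p => ~~ (p ^ 2 %| n)%N) (primes n)
  then (-1) ^+ size (primes n)
  else 0.

Definition ramanujan_sum (d : nat) (l : int) : int :=
  \sum_(e <- divisors d | (e%:Z %| l)%Z) mobius (d %/ e)%N * e%:Z.

(* Main.v *)
(* Let [w] be a primitive [n]-th root of unity.  The root-of-unity filter gives
   n S_n^i(f) = sum_(a < n) f(w^a) w^(-a i), and the terms are grouped by the
   order [d] of [w^a].  At a root of order [d] the q-Lucas theorem evaluates the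
   q-multinomial as 0 when R_d >= d, and otherwise as the multinomial of the
   quotients times the q-multinomial [g] of the residues; expanding [g] over
   exponents modulo [d] leaves sums of powers of all roots of order [d], which
   are Ramanujan sums.  The q-Lucas theorem itself follows by writing [m]! as
   [d]^(m %/ d) times a cofactor that does not vanish at the root, and
   cancelling the powers of [d] before evaluating. *)
Require Import Defs.
From mathcomp Require Import all_boot all_order all_algebra all_field.
From mathcomp Require Import ring.

Set Implicit Arguments.
Unset Strict Implicit.
Unset Printing Implicit Defensive.

Import GRing.Theory.
Local Open Scope ring_scope.

(** * q-integers, q-factorials and integrality of the q-multinomial *)

Definition qnat (t : nat) : {poly int} := \sum_(0 <= u < t) 'X^u.

Lemma qfact0 : qfact 0 = 1.
Proof. by rewrite /qfact big_geq. Qed.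

Lemma qfactS m : qfact m.+1 = qfact m * qnat m.+1.
Proof. by rewrite /qfact big_nat_recr. Qed.

Lemma qnatD a b : qnat (a + b) = qnat a + 'X^a * qnat b.
Proof.
rewrite /qnat (@big_cat_nat _ _ _ a) ?leq_addr //=; congr (_ + _).
rewrite -{1}[a]add0n big_addn addKn mulr_sumr.
by apply: eq_bigr => u _; rewrite -exprD addnC.
Qed.

Lemma qnatM q d : qnat (q * d) = qnat d * \sum_(u < q) 'X^(u * d).
Proof.
elim: q => [|q IHq]; first by rewrite big_ord0 mulr0 /qnat big_geq.
by rewrite mulSnr qnatD IHq big_ord_recr mulrDr [_ * 'X^_]mulrC.
Qed.

Lemma size_qnat t : size (qnat t) = t.
Proof.
elim: t => [|t IHt]; first by rewrite /qnat big_geq // size_poly0.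
rewrite /qnat big_nat_recr //= addrC size_polyDl ?size_polyXn //.
by rewrite -/(qnat t) IHt.
Qed.

Lemma qnat_monic t : qnat t.+1 \is monic.
Proof.
rewrite /qnat big_nat_recr //= addrC monicE lead_coefDl ?lead_coefXn //.
by rewrite size_polyXn -/(qnat t) size_qnat.
Qed.

Lemma qfact_monic m : qfact m \is monic.
Proof.
elim: m => [|m IHm]; first by rewrite qfact0 monic1.
by rewrite qfactS monicMl // qnat_monic.
Qed.

Lemma qfact_prod_monic I (r : seq I) (k : I -> nat) :
  \prod_(x <- r) qfact (k x) \is monic.
Proof. by apply: monic_prod => x _; exact: qfact_monic. Qed.

(* Pascal's rule in the form [a + b] = [a] + q^a [b]. *)
Lemma qfact_dvd_add a b : exists g, qfact (a + b) = g * (qfact a * qfact b).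
Proof.
(* The induction is on [a + b], since one term of Pascal's rule lowers [a] and the other lowers
   [b]. *)
have [m] := ubnP (a + b)%N; elim: m a b => // m IHm [|a] [|b] lt_ab_m.
- by exists 1; rewrite qfact0 !mul1r.
- by exists 1; rewrite qfact0 !mul1r.
- by exists 1; rewrite addn0 qfact0 mulr1 mul1r.
have [g1 Eg1] := IHm a b.+1 lt_ab_m.
have [g2 Eg2] : exists g, qfact (a.+1 + b) = g * (qfact a.+1 * qfact b).
  by apply: IHm; rewrite addSnnS.
exists (g1 + 'X^(a.+1) * g2); rewrite addSn qfactS -addSn qnatD mulrDr.
by rewrite {1}Eg1 -addSnnS Eg2 !qfactS; ring.
Qed.

Lemma qfact_prod_dvd_sum I (r : seq I) (k : I -> nat) :
  exists g, qfact (\sum_(x <- r) k x)%N = g * \prod_(x <- r) qfact (k x).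
Proof.
elim: r => [|x r [g Eg]]; first by exists 1; rewrite !big_nil qfact0 mulr1.
have [h Eh] := qfact_dvd_add (k x) (\sum_(y <- r) k y).
by exists (h * g); rewrite !big_cons Eh Eg; ring.
Qed.

(** The denominator divides [qfact j] and is monic, so the quotient in the definition is exact and
    can be traded for a product identity. *)
Lemma qmultinomialK j l (k : 'I_l -> nat) : (\sum_(x < l) k x)%N = j ->
  qmultinomial j k * \prod_(x < l) qfact (k x) = qfact j.
Proof.
move=> Ej; rewrite /qmultinomial Ej eqxx.
have [g] := qfact_prod_dvd_sum (index_enum 'I_l) k; rewrite Ej => ->.
by rewrite Pdiv.IdomainMonic.mulpK // qfact_prod_monic.
Qed.

Lemma multinomialK m l (a : 'I_l -> nat) : (\sum_(x < l) a x)%N = m ->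
  (multinomial m a * \prod_(x < l) (a x)`!)%N = m`!.
Proof.
move=> Em; rewrite /multinomial Em eqxx divnK // -{}Em.
elim: (index_enum _) => [|x r IHr]; first by rewrite !big_nil.
rewrite !big_cons; apply: dvdn_trans (dvdn_mul (dvdnn _) IHr) _.
set b := (\sum_(y <- r) a y)%N; rewrite -(@bin_fact (a x + b) (a x)) ?leq_addr //.
by rewrite addKn dvdn_mull.
Qed.

(** * Evaluation at roots of unity and the q-Lucas theorem *)

Local Notation ev z f := (map_poly intr f).[z].

Section RootOfUnity.
Variable F : numFieldType.
Implicit Types (f g : {poly int}) (z : F).

Lemma evM z f g : ev z (f * g) = ev z f * ev z g.
Proof. by rewrite rmorphM hornerM. Qed.

Lemma evD z f g : ev z (f + g) = ev z f + ev z g.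
Proof. by rewrite rmorphD hornerD. Qed.

Lemma evXn z m : ev z 'X^m = z ^+ m.
Proof. by rewrite map_polyXn hornerXn. Qed.

Lemma ev1 z : ev z 1 = 1.
Proof. by rewrite rmorph1 hornerC. Qed.

Lemma ev_exp z f m : ev z (f ^+ m) = ev z f ^+ m.
Proof. by rewrite rmorphXn horner_exp. Qed.

Lemma ev_sum z I (r : seq I) (P : pred I) (G : I -> {poly int}) :
  ev z (\sum_(x <- r | P x) G x) = \sum_(x <- r | P x) ev z (G x).
Proof. by rewrite rmorph_sum horner_sum. Qed.

Lemma ev_prod z I (r : seq I) (P : pred I) (G : I -> {poly int}) :
  ev z (\prod_(x <- r | P x) G x) = \prod_(x <- r | P x) ev z (G x).
Proof. by rewrite rmorph_prod horner_prod. Qed.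

(** The geometric sum, kept multiplied by [z - 1] so that it also covers [z = 1]. *)
Lemma ev_qnat z t : (z - 1) * ev z (qnat t) = z ^+ t - 1.
Proof.
rewrite subrX1 ev_sum big_mkord; congr (_ * _).
by apply: eq_bigr => u _; rewrite evXn.
Qed.

Variables (d : nat) (z : F).
Hypothesis zP : d.-primitive_root z.

Let d_gt0 : (0 < d)%N. Proof. exact: prim_order_gt0 zP. Qed.

Lemma ev_qnat_neq0 r : (0 < r < d)%N -> ev z (qnat r) != 0.
Proof.
case/andP=> r_gt0 lt_rd; apply/eqP=> qr0.
have /eqP := ev_qnat z r; rewrite qr0 mulr0 eq_sym subr_eq0.
by rewrite -(prim_order_dvd zP) gtnNdvd.
Qed.

Lemma ev_qfact_neq0 r : (r < d)%N -> ev z (qfact r) != 0.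
Proof.
elim: r => [|r IHr] lt_rd; first by rewrite qfact0 ev1 oner_eq0.
by rewrite qfactS evM mulf_neq0 ?IHr ?ev_qnat_neq0 // ltnW.
Qed.

Lemma ev_qnat_order : (1 < d)%N -> ev z (qnat d) = 0.
Proof.
move=> d_gt1; have /eqP := ev_qnat z d; rewrite (prim_expr_order zP) subrr.
rewrite mulf_eq0 subr_eq0 -[z]expr1 -(prim_order_dvd zP) gtnNdvd //=.
by move/eqP; rewrite expr1.
Qed.

(* The factor [qnat d] accounts for all the zeros of [qfact m] at [z]. *)
Lemma qfact_factor m : exists2 h,
  qfact m = qnat d ^+ (m %/ d) * h
  & ev z h = (m %/ d)`!%:R * ev z (qfact d.-1) ^+ (m %/ d)
             * ev z (qfact (m %% d)).
Proof.
elim: m => [|m [h Eh evh]].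
  by exists 1; rewrite ?div0n ?mod0n ?expr0 ?qfact0 ?ev1 ?fact0 ?mulr1.
set q := (m %/ d)%N in Eh evh; set r := (m %% d)%N in evh.
have Em : m.+1 = (q * d + r.+1)%N by rewrite addnS -divn_eq.
have: (r < d)%N by rewrite ltn_mod.
(* If [r.+1 = d], the new factor is [qnat d] times a sum worth [q.+1] at [z], which extends the
   factorial. Otherwise the new factor has the value of [qnat r.+1] at [z]. *)
rewrite leq_eqVlt => /predU1P[Er | lt_r1d].
  have {}Em : m.+1 = (q.+1 * d)%N by rewrite Em Er mulSnr.
  have Edr : d.-1 = r by rewrite -Er.
  exists (h * \sum_(u < q.+1) 'X^(u * d)).
    by rewrite qfactS Em mulnK // qnatM Eh exprSr; ring.
  rewrite Em mulnK // modnMl qfact0 ev1 mulr1 evM evh ev_sum.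
  under eq_bigr => u _ do
    rewrite evXn mulnC exprM (prim_expr_order zP) expr1n.
  by rewrite sumr_const card_ord factS natrM exprSr -Edr; ring.
have [-> ->] : (m.+1 %/ d)%N = q /\ (m.+1 %% d)%N = r.+1.
  by rewrite Em divnMDl // modnMDl divn_small // addn0 modn_small.
exists (h * qnat m.+1); first by rewrite qfactS Eh mulrA.
rewrite evM evh Em qnatD evD evM evXn mulnC exprM (prim_expr_order zP) expr1n.
rewrite mulnC qnatM evM ev_qnat_order; last exact: leq_ltn_trans lt_r1d.
by rewrite mul0r add0r mul1r qfactS evM mulrA.
Qed.

Variables (l : nat) (k : 'I_l -> nat).
Local Notation R := (\sum_(x < l) k x %% d)%N.
Local Notation Q := (\sum_(x < l) k x %/ d)%N.

Lemma sum_divn_eq : (\sum_(x < l) k x = Q * d + R)%N.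
Proof.
by rewrite big_distrl -big_split; apply: eq_bigr => x _ /=; exact: divn_eq.
Qed.

(** Obtained by multiplying [qfact_factor] over all [k x]: [h] is the denominator stripped of its
    power of [qnat d], so its value at [z] is nonzero and can be cancelled. *)
Lemma qmultinomial_factor : exists2 h,
  let j := (\sum_(x < l) k x)%N in
  qnat d ^+ Q * (qmultinomial j k * h) = qfact j
  & ev z h = ev z (qfact d.-1) ^+ Q * (\prod_(x < l) (k x %/ d)`!)%:R
             * ev z (\prod_(x < l) qfact (k x %% d)).
Proof.
have [h Eh evh] : exists2 h,
    \prod_(x < l) qfact (k x) = qnat d ^+ Q * h
    & ev z h = ev z (qfact d.-1) ^+ Q * (\prod_(x < l) (k x %/ d)`!)%:R
             * ev z (\prod_(x < l) qfact (k x %% d)).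
  elim: (index_enum _) => [|x r [h Eh evh]].
    by exists 1; rewrite !big_nil ?expr0 ?ev1 ?mulr1.
  have [g Eg evg] := qfact_factor (k x).
  exists (g * h); rewrite !big_cons; first by rewrite Eg Eh exprD; ring.
  by rewrite !evM evg evh exprD natrM; ring.
by exists h => //=; rewrite mulrCA -Eh qmultinomialK.
Qed.

(* The q-Lucas theorem at a primitive root of unity of order [d]. *)
Lemma ev_qmultinomial_lt (j := (\sum_(x < l) k x)%N) : (R < d)%N ->
  ev z (qmultinomial j k) =
  (multinomial (j %/ d) (fun x => k x %/ d)%N)%:R
  * ev z (qmultinomial (j %% d) (fun x => k x %% d)%N).
Proof.
move=> lt_Rd; have Ej : j = (Q * d + R)%N by exact: sum_divn_eq.
have EQ : Q = (j %/ d)%N by rewrite Ej divnMDl // divn_small // addn0.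
have ER : R = (j %% d)%N by rewrite Ej modnMDl modn_small.
have [h Eh evh] := qmultinomial_factor; have [g Eg evg] := qfact_factor j.
have /(congr1 (fun f => ev z f)) : qmultinomial j k * h = g.
  (* The power of [qnat d] is cancelled between polynomials, before evaluation, because [qnat d] may
     vanish at [z]. *)
  apply/(mulfI (x := qnat d ^+ Q)); last by rewrite Eh EQ -Eg.
  by rewrite expf_neq0 // -(prednK d_gt0) monic_neq0 ?qnat_monic.
rewrite evM evh evg -EQ -ER -(multinomialK (erefl Q)) -(qmultinomialK (erefl R)).
rewrite natrM evM.
set A := ev z _; set D := _ ^+ Q; set M := (\prod_(x < l) _)%:R.
set P := ev z (\prod_(x < l) _) => E.
have nz : D * M * P != 0.
  rewrite !mulf_neq0 ?expf_neq0 ?ev_qfact_neq0 ?prednK //.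
    by rewrite Num.Theory.pnatr_eq0 -lt0n prodn_gt0 // => x; rewrite fact_gt0.
  rewrite /P ev_prod; apply/prodf_neq0 => x _.
  by rewrite ev_qfact_neq0 // ltn_mod.
by apply: (mulIf nz); rewrite E; ring.
Qed.

(** A carry among the residues gives the numerator more factors [qnat d] than the denominator, and a
    surplus factor vanishes at [z]. *)
Lemma ev_qmultinomial_ge : (d <= R)%N ->
  ev z (qmultinomial (\sum_(x < l) k x) k) = 0.
Proof.
set j := (\sum_(x < l) k x)%N => le_dR.
have Ej : j = (Q * d + R)%N by exact: sum_divn_eq.
(* For [d = 1] all residues are 0, against [le_dR]; [qnat d] vanishes at [z] only when [d > 1]. *)
have d_gt1 : (1 < d)%N.
  rewrite ltn_neqAle d_gt0 andbT; apply: contraL le_dR => /eqP <-.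
  by rewrite big1 // => x _; rewrite modn1.
have ltQ : (Q < j %/ d)%N.
  by rewrite Ej divnMDl // -addn1 leq_add2l divn_gt0.
have [h Eh evh] := qmultinomial_factor; have [g Eg evg] := qfact_factor j.
have /(congr1 (fun f => ev z f)) :
    qmultinomial j k * h = qnat d ^+ (j %/ d - Q) * g.
  apply/(mulfI (x := qnat d ^+ Q)); last first.
    by rewrite Eh mulrA -exprD subnKC 1?ltnW.
  by rewrite expf_neq0 // -(prednK d_gt0) monic_neq0 ?qnat_monic.
rewrite !evM ev_exp ev_qnat_order // expr0n subn_eq0 leqNgt ltQ mul0r.
move/eqP; rewrite mulf_eq0 => /orP[/eqP // | /idPn[]].
rewrite evh !mulf_neq0 ?expf_neq0 ?ev_qfact_neq0 ?prednK //.
  by rewrite Num.Theory.pnatr_eq0 -lt0n prodn_gt0 // => x; rewrite fact_gt0.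
rewrite ev_prod; apply/prodf_neq0 => x _.
by rewrite ev_qfact_neq0 // ltn_mod.
Qed.

End RootOfUnity.

(** * Divisor sums of the Möbius function *)

Lemma mobius_mul_prime p h : prime p -> (0 < h)%N -> ~~ (p %| h)%N ->
  mobius (p * h) = - mobius h.
Proof.
move=> p_pr h_gt0 pNh.
have perm_ph : perm_eq (primes (p * h)) (p :: primes h).
  apply: uniq_perm; rewrite /= ?primes_uniq ?andbT ?mem_primes ?(negPf pNh) ?andbF //.
  by move=> q; rewrite primesM ?(prime_gt0 p_pr) // (primes_prime p_pr) !inE.
rewrite /mobius (perm_all _ perm_ph) (perm_size perm_ph) /=.
have -> : ~~ (p ^ 2 %| p * h)%N by rewrite -mulnn dvdn_pmul2l // prime_gt0.
have -> : all (fun q => ~~ (q ^ 2 %| p * h)%N) (primes h)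
        = all (fun q => ~~ (q ^ 2 %| h)%N) (primes h).
  apply: eq_in_all => q; rewrite mem_primes => /and3P[q_pr _ qh].
  rewrite Gauss_dvdr // coprimeXl // prime_coprime // dvdn_prime2 //.
  by apply: contraNneq pNh => <-.
by rewrite /=; case: ifP => _; rewrite ?oppr0 // exprS mulN1r.
Qed.

Lemma mobius_square p h : prime p -> (0 < h)%N -> (p ^ 2 %| h)%N -> mobius h = 0.
Proof.
move=> p_pr h_gt0 p2h; rewrite /mobius ifF //; apply/negbTE/allPn; exists p.
  by rewrite mem_primes p_pr h_gt0 (dvdn_trans _ p2h) ?dvdn_exp.
by rewrite negbK.
Qed.

(** For a prime [p] dividing [N > 1], the divisors divisible by [p ^ 2] contribute 0, and the others
    cancel in pairs [h], [p * h] with [p] not dividing [h]. *)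
Lemma sum_mobius N : (0 < N)%N ->
  \sum_(g <- divisors N) mobius g = (N == 1)%N%:R.
Proof.
move=> N_gt0; case: eqVneq => [-> | N_neq1].
  by rewrite big_cons big_nil addr0.
have N_gt1 : (1 < N)%N by rewrite ltn_neqAle eq_sym N_neq1.
set p := pdiv N; have p_pr : prime p by exact: pdiv_prime.
have [M EN] := dvdnP (pdiv_dvd N); rewrite -/p in EN.
have M_gt0 : (0 < M)%N by move: N_gt0; rewrite EN muln_gt0 => /andP[].
pose S := [seq g <- divisors N | ~~ (p %| g)%N].
rewrite (bigID (fun g => p %| g)%N) /=.
rewrite (bigID (fun g => p ^ 2 %| g)%N) /= big1_seq ?add0r; last first.
  move=> g /andP[/andP[_ p2g]]; rewrite -dvdn_divisors // => gN.
  exact: mobius_square (dvdn_gt0 N_gt0 gN) p2g.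
rewrite -big_filter -[X in _ + X]big_filter -/S.
have perm_pS : perm_eq
    [seq g <- divisors N | (p %| g)%N && ~~ (p ^ 2 %| g)%N] (map (muln p) S).
  apply: uniq_perm; rewrite ?filter_uniq ?divisors_uniq //.
    rewrite map_inj_uniq ?filter_uniq ?divisors_uniq // => x y /eqP.
    by rewrite eqn_pmul2l ?prime_gt0 // => /eqP.
  move=> g; rewrite mem_filter -dvdn_divisors //.
  apply/idP/mapP => [/andP[/andP[/dvdnP[h ->] p2g] gN] | [h hS ->]].
    rewrite mulnC -mulnn dvdn_pmul2l ?prime_gt0 // in p2g.
    exists h; last by rewrite mulnC.
    by rewrite mem_filter p2g -dvdn_divisors // (dvdn_trans _ gN) ?dvdn_mulr.
  move: hS; rewrite mem_filter -dvdn_divisors // => /andP[pNh hN].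
  rewrite dvdn_mulr // -mulnn !dvdn_pmul2l ?prime_gt0 // pNh /=.
  rewrite EN mulnC dvdn_pmul2r ?prime_gt0 //.
  by rewrite EN Gauss_dvdl // in hN; rewrite coprime_sym prime_coprime.
rewrite (perm_big _ perm_pS) big_map -big_split big1_seq //= => h.
rewrite mem_filter -dvdn_divisors // => /andP[pNh hN].
by rewrite mobius_mul_prime ?(dvdn_gt0 N_gt0 hN) // addNr.
Qed.

(** When [d = N * o], substituting [e = d %/ g] with [g] running over the divisors of [N] reduces
    the sum to [sum_mobius]. *)
Lemma sum_mobius_quotient d o : (0 < d)%N ->
  \sum_(e <- divisors d | (o %| e)%N) mobius (d %/ e) = (o == d)%:R.
Proof.
move=> d_gt0; have [od|oNd] := boolP (o %| d)%N; last first.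
  rewrite big1_seq; first by case: eqP oNd => // ->; rewrite dvdnn.
  move=> e /andP[oe]; rewrite -dvdn_divisors // => ed.
  by rewrite (dvdn_trans oe ed) in oNd.
have o_gt0 := dvdn_gt0 d_gt0 od; have [N Ed] := dvdnP od.
have N_gt0 : (0 < N)%N by move: d_gt0; rewrite Ed muln_gt0 => /andP[].
rewrite -big_filter.
have perm_d : perm_eq [seq e <- divisors d | (o %| e)%N]
    (map (fun g => d %/ g)%N (divisors N)).
  apply: uniq_perm; rewrite ?filter_uniq ?divisors_uniq //.
    rewrite map_inj_in_uniq ?divisors_uniq // => x y.
    rewrite -!dvdn_divisors // => xN yN Exy.
    have xd : (x %| d)%N by rewrite Ed dvdn_mulr.
    have yd : (y %| d)%N by rewrite Ed dvdn_mulr.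
    apply/eqP; rewrite -(eqn_pmul2l (_ : 0 < d %/ x)%N).
      by rewrite {2}Exy !divnK.
    by rewrite divn_gt0 ?(dvdn_leq d_gt0 xd) ?(dvdn_gt0 d_gt0 xd).
  move=> e; rewrite mem_filter -dvdn_divisors //.
  apply/andP/mapP => [[oe ed] | [g]].
    have e_gt0 := dvdn_gt0 d_gt0 ed.
    exists (d %/ e)%N; last by rewrite divnA // mulKn.
    have [m Em] := dvdnP oe; have [m' Em'] := dvdnP ed.
    rewrite -dvdn_divisors // Em' mulnK //.
    move: Ed; rewrite Em' Em mulnA => /eqP; rewrite eqn_pmul2r // => /eqP <-.
    exact: dvdn_mulr.
  rewrite -dvdn_divisors // => gN ->; have g_gt0 := dvdn_gt0 N_gt0 gN.
  have [m Em] := dvdnP gN.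
  have -> : (d %/ g = m * o)%N by rewrite Ed Em mulnAC mulnK.
  by rewrite dvdn_mull // Ed Em mulnAC dvdn_mulr.
rewrite (perm_big _ perm_d) big_map.
have -> : (o == d) = (N == 1%N).
  by rewrite Ed -{1}[o]mul1n eqn_pmul2r // eq_sym.
rewrite -sum_mobius //; apply: eq_big_seq => g; rewrite -dvdn_divisors // => gN.
have gd : (g %| d)%N by rewrite Ed dvdn_mulr.
by rewrite divnA // mulKn.
Qed.

(** * Ramanujan sums as power sums over roots of a given order *)

Section RamanujanSum.
Variables (F : numFieldType) (n : nat) (w : F).
Hypothesis wP : n.-primitive_root w.

Let n_gt0 : (0 < n)%N. Proof. exact: prim_order_gt0 wP. Qed.

Lemma prim_root_exprz_eq1 d (z : F) (m : int) : d.-primitive_root z ->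
  (z ^ m == 1) = (d%:Z %| m)%Z.
Proof.
move=> zP; rewrite dvdzE; case: m => m /=.
  by rewrite -exprnP -(prim_order_dvd zP).
by rewrite NegzE -exprnN invr_eq1 -(prim_order_dvd zP).
Qed.

(** A geometric sum of ratio [z ^ m], whose [d]-th power is 1: it vanishes unless the ratio itself
    is 1. *)
Lemma sum_exprz_prim_root d (z : F) (m : int) : d.-primitive_root z ->
  \sum_(b < d) (z ^+ b) ^ m = ((d%:Z %| m)%Z * d)%:R.
Proof.
move=> zP; under eq_bigr => b _ do rewrite exprnP exprzAC -exprnP.
have := subrX1 (z ^ m) d; rewrite exprnP exprzAC -exprnP.
rewrite (prim_expr_order zP) exp1rz subrr => /esym/eqP.
rewrite mulf_eq0 subr_eq0 (prim_root_exprz_eq1 _ zP).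
case: (boolP (d%:Z %| m)%Z) => [dm _ | _ /= /eqP->]; last by rewrite mul0n.
rewrite mul1n; move: dm; rewrite -(prim_root_exprz_eq1 _ zP) => /eqP ->.
by under eq_bigr => b _ do rewrite expr1n; rewrite sumr_const card_ord.
Qed.

(** By [exp_prim_root], this is the order of [w ^+ a]. *)
Local Notation ord a := (n %/ gcdn a n)%N.

Lemma dvdn_ord a e : (ord a %| e)%N = (n %| a * e)%N.
Proof.
have wa := exp_prim_root wP a.
by rewrite (prim_order_dvd wa) -exprM -(prim_order_dvd wP).
Qed.

(** With [n = c * e], the condition selects the multiples [a] of [c], so [w ^+ a] runs over the
    powers of the primitive [e]-th root [w ^+ c]. *)
Lemma sum_exprz_ord_dvdn e (m : int) : (e %| n)%N ->
  \sum_(a < n | (ord a %| e)%N) (w ^+ a) ^ m = ((e%:Z %| m)%Z * e)%:R.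
Proof.
case/dvdnP=> c En; have := n_gt0; rewrite {1}En muln_gt0 => /andP[c_gt0 e_gt0].
have zP : e.-primitive_root (w ^+ c).
  have := exp_prim_root wP c; rewrite (gcdn_idPl _) ?En ?dvdn_mulr //.
  by rewrite mulKn.
rewrite -(sum_exprz_prim_root m zP).
rewrite (eq_bigl (fun a : 'I_n => c %| a)%N); last first.
  by move=> a; rewrite dvdn_ord {1}En dvdn_pmul2r.
have lt_cb (b : 'I_e) : (c * b < n)%N by rewrite En ltn_pmul2l.
have lt_ac (a : 'I_n) : (a %/ c < e)%N by rewrite ltn_divLR // mulnC -En.
rewrite (reindex_onto (fun b => Ordinal (lt_cb b)) (fun a => Ordinal (lt_ac a))).
  rewrite /=; apply: eq_big => [b|b _]; last by rewrite /= exprM.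
  by rewrite dvdn_mulr //; apply/eqP/val_inj; rewrite /= mulKn.
by move=> a ca; apply/val_inj; rewrite /= mulnC divnK.
Qed.

(** Möbius inversion: the power sums over orders dividing [e] are known, and [sum_mobius_quotient]
    isolates the order [d]. *)
Lemma ramanujan_sumE d (m : int) : (d %| n)%N ->
  (ramanujan_sum d m)%:~R = \sum_(a < n | ord a == d) (w ^+ a) ^ m.
Proof.
move=> dn; have d_gt0 := dvdn_gt0 n_gt0 dn.
transitivity (\sum_(e <- divisors d) (mobius (d %/ e))%:~R *
    \sum_(a < n | (ord a %| e)%N) (w ^+ a) ^ m).
  rewrite /ramanujan_sum big_mkcond rmorph_sum; apply: eq_big_seq => e.
  rewrite -dvdn_divisors // => ed; rewrite sum_exprz_ord_dvdn ?(dvdn_trans ed) //.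
  by case: ifP => _; rewrite ?rmorph0 ?mul0n ?mulr0 // rmorphM mul1n.
under eq_bigr => e _ do rewrite mulr_sumr.
rewrite (exchange_big_dep xpredT) //= [RHS]big_mkcond /=; apply: eq_bigr => a _.
rewrite -mulr_suml -rmorph_sum /= sum_mobius_quotient //.
by case: eqP => _; rewrite ?mul1r ?mul0r.
Qed.

Lemma sum_by_order (G : nat -> F) :
  \sum_(a < n) G a = \sum_(d <- divisors n) \sum_(a < n | ord a == d) G a.
Proof.
rewrite (exchange_big_dep xpredT) //=; apply: eq_bigr => a _.
rewrite -big_filter (_ : [seq d <- _ | _] = [:: ord a]) ?big_seq1 //.
apply: perm_small_eq => //; apply: uniq_perm => //.
  by rewrite filter_uniq ?divisors_uniq.
move=> d; rewrite mem_filter inE eq_sym -dvdn_divisors //.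
by apply: andb_idr => /eqP <-; rewrite dvdn_div // dvdn_gcdr.
Qed.

End RamanujanSum.

(** The filter produces exponents [s - i], while the final formula has [i - s]. *)
Lemma ramanujan_sumN d m : ramanujan_sum d (- m) = ramanujan_sum d m.
Proof. by apply: eq_bigl => e; rewrite !dvdzE abszN. Qed.

(** * The root-of-unity filter *)

Section CoefSumMod.
Variables (F : numFieldType) (n : nat) (w : F).
Hypothesis wP : n.-primitive_root w.

Let n_gt0 : (0 < n)%N. Proof. exact: prim_order_gt0 wP. Qed.

Lemma ev_coef z (f : {poly int}) :
  ev z f = \sum_(t < size f) (f`_t)%:~R * z ^+ t :> F.
Proof.
rewrite (@horner_coef_wide _ (size f)) ?size_poly //.
by apply: eq_bigr => t _; rewrite coef_map.
Qed.

(** Exponents fold modulo [n] because [w ^+ n = 1], and each [t] falls in the single class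
    [t %% n]. *)
Lemma ev_coef_sum_mod (f : {poly int}) :
  ev w f = \sum_(0 <= s < n) (coef_sum_mod n s f)%:~R * w ^+ s.
Proof.
rewrite ev_coef big_mkord.
under [RHS]eq_bigr => s _ do rewrite /coef_sum_mod rmorph_sum mulr_suml.
rewrite [RHS](exchange_big_dep xpredT) //=; apply: eq_bigr => t _.
rewrite (big_pred1 (Ordinal (ltn_pmod t n_gt0))) /= ?(prim_expr_mod wP) // => s.
rewrite /= -val_eqE /= !modz_nat eqz_nat (modn_small (ltn_ord s)).
by rewrite eq_sym.
Qed.

(** Summing over [a] first, the coefficient at [t] meets a power sum of exponent [t - i], worth [n]
    or 0 by [sum_exprz_prim_root]. *)
Lemma coef_sum_mod_filter (i : int) (f : {poly int}) :
  n%:R * (coef_sum_mod n i f)%:~R = \sum_(a < n) ev (w ^+ a) f * (w ^+ a) ^ (- i).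
Proof.
rewrite /coef_sum_mod rmorph_sum big_mkcond mulr_sumr /=.
under [RHS]eq_bigr => a _ do rewrite ev_coef mulr_suml.
rewrite exchange_big; apply: eq_bigr => t _ /=.
have w_neq0 : w != 0 by rewrite (prim_root_eq0 wP) -lt0n.
under eq_bigr => a _ do rewrite -mulrA [_ ^+ t]exprnP -expfzDr ?expf_neq0 //.
rewrite -mulr_sumr (sum_exprz_prim_root _ wP) eqz_mod_dvd.
by case: ifP => _; rewrite ?mul1n ?mul0n ?mulr0 // mulrC.
Qed.

End CoefSumMod.

(** * Assembly of the formula *)

Lemma coef_sum_mod0 d s : coef_sum_mod d s 0 = 0.
Proof. by rewrite /coef_sum_mod big1 // => t _; rewrite coef0. Qed.

(** The case where the [k x] add up to [j], multiplied by [n] to stay in the integers. It is proved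
    in [algC], which has a primitive [n]-th root, and descends by injectivity of [intr]. *)
Lemma coef_sum_mod_qmultinomial n (n_gt0 : (0 < n)%N) l (k : 'I_l -> nat) i
    (j := (\sum_(x < l) k x)%N) :
  n%:R * coef_sum_mod n i (qmultinomial j k) =
  \sum_(d <- divisors n | (\sum_(x < l) (k x %% d)%N < d)%N)
    (multinomial (j %/ d)%N (fun x : 'I_l => (k x %/ d)%N))%:R *
    (\sum_(0 <= s < d)
       coef_sum_mod d s%:Z
         (qmultinomial (j %% d)%N (fun x : 'I_l => (k x %% d)%N)) *
       ramanujan_sum d (i - s%:Z)).
Proof.
have [w wP] := C_prim_root_exists n_gt0.
have w_neq0 : w != 0 by rewrite (prim_root_eq0 wP) -lt0n.
apply: (@intr_inj algC); rewrite rmorphM /= rmorph_nat.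
rewrite (coef_sum_mod_filter wP).
rewrite (sum_by_order wP (fun a => ev (w ^+ a) _ * (w ^+ a) ^ (- i))).
rewrite [in RHS]big_mkcond rmorph_sum; apply: eq_big_seq => d.
rewrite -dvdn_divisors // => dn; have d_gt0 := dvdn_gt0 n_gt0 dn.
have ordP (a : 'I_n) : (n %/ gcdn a n == d)%N -> d.-primitive_root (w ^+ a).
  by move/eqP <-; exact: exp_prim_root.
case: ltnP => [lt_Rd | le_dR]; last first.
  by rewrite rmorph0 big1 // => a /ordP aP; rewrite (ev_qmultinomial_ge aP) ?mul0r.
rewrite rmorphM /= rmorph_nat rmorph_sum /= mulr_sumr big_mkord.
under [RHS]eq_bigr => s _ do
  rewrite rmorphM /= -ramanujan_sumN opprB (ramanujan_sumE wP) // 2!mulr_sumr.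
rewrite [RHS]exchange_big; apply: eq_bigr => a /ordP aP /=.
rewrite (ev_qmultinomial_lt aP) // (ev_coef_sum_mod aP) big_mkord.
rewrite -mulrA mulr_suml mulr_sumr; apply: eq_bigr => s _.
by rewrite -mulrA exprnP expfzDr ?expf_neq0.
Qed.

Theorem theorem4p2 (n : nat) (n_gt0 : (0 < n)%N) (j l : nat)
    (k : 'I_l -> nat) (i : int) :
  (coef_sum_mod n i (qmultinomial j k))%:~R =
  n%:R^-1 *
  \sum_(d <- divisors n | (\sum_(x < l) (k x %% d)%N < d)%N)
    (multinomial (j %/ d)%N (fun x : 'I_l => (k x %/ d)%N))%:R *
    (\sum_(0 <= s < d)
       coef_sum_mod d s%:Z
         (qmultinomial (j %% d)%N (fun x : 'I_l => (k x %% d)%N)) *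
       ramanujan_sum d (i - s%:Z))%:~R :> rat.
Proof.
have [<- | neq_j] := eqVneq (\sum_(x < l) k x)%N j.
  have n_neq0 : n%:R != 0 :> rat by rewrite Num.Theory.pnatr_eq0 -lt0n.
  apply: (mulfI n_neq0); rewrite mulVKf //.
  have /(congr1 (intr : int -> rat)) := coef_sum_mod_qmultinomial n_gt0 k i.
  rewrite rmorphM /= rmorph_nat => ->; rewrite rmorph_sum.
  by apply: eq_bigr => d _; rewrite rmorphM /= rmorph_nat.
(* Here the left side is 0. On the right, quotients adding up to [j %/ d] and residues to [j %% d]
   would force the [k x] to add up to [j], so for each [d] one of the two coefficients is 0. *)
rewrite [qmultinomial j k]/qmultinomial (negPf neq_j) coef_sum_mod0 big1 ?mulr0 //.
move=> d lt_Rd; rewrite /multinomial; case: eqP => [Q_j | _]; last by rewrite mul0r.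
rewrite /qmultinomial ifN.
  by rewrite [X in X%:~R]big1 ?mulr0 // => s _; rewrite coef_sum_mod0 mul0r.
apply: contra neq_j => /eqP R_j.
by rewrite (sum_divn_eq d) Q_j R_j -divn_eq.
Qed.
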